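(* Let $\gamma$ be a $3$-Frenet helix, with constant curvatures $\kappa,\tau$, parametrized by the arc length $s$ in a $3$-dimensional Lorentzian space form $N^3_1(c)$ with $c\ne0$. (i) If $c<0$ and the normal vector field $N$ is space-like, then $\gamma$ is a proper biharmonic curve if and only if $\tau^2-\kappa^2=-c$. (ii) If $c<0$ and the normal vector field $N$ is time-like, then $\gamma$ is a proper biharmonic curve if and only if $\tau^2+\kappa^2=-c$. (iii) If $c>0$ and the normal vector field $N$ is space-like, then $\gamma$ is a proper biharmonic curve if and only if $\kappa^2=\tau^2+c$. (iv) If $c>0$ and the normal vector field $N$ is time-like, then $\gamma$ cannot be proper biharmonic.
   Context: Conventions. For a semi-Riemannian manifold $(M,\langle\,,\rangle)$ with Levi-Civita connection $\nabla$, $R(X,Y)Z=\nabla_X\nabla_YZ-\nabla_Y\nabla_XZ-\nabla_{[X,Y]}Z$. Curves $\gamma:I\to M$ ($I$ an open real interval) are smooth, nonnull, parametrized by arc length; $T=\gamma'$. A curve is biharmonic if $\tau_2(\gamma)=\nabla_T\nabla_T\nabla_TT+R(\nabla_TT,T)T=0$, and proper biharmonic if it is biharmonic and not a geodesic. A $3$-Frenet curve in the $3$-dimensional ambient space is a curve admitting a frame $\{T,N,B\}$ along it with $\langle T,T\rangle=\epsilon_1$, $\langle N,N\rangle=\epsilon_2$, $\langle B,B\rangle=\epsilon_3$, each $\pm1$, mutually orthogonal, and $\nabla_TT=\epsilon_2kN$, $\nabla_TN=-\epsilon_1kT+\epsilon_3\tau B$, $\nabla_TB=-\epsilon_2\tau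 N$, where $k(s)>0$ and $\tau(s)$ is positive (or real valued when the space is oriented, $B$ being then chosen so that $\{T,N,B\}$ is positively oriented). It is a helix if the curvatures are constant, denoted $\kappa,\tau$. $N$ is space-like if $\epsilon_2=1$, time-like if $\epsilon_2=-1$. Let $\mathbb{R}^4_t$ be $\mathbb{R}^4$ with $\langle x,y\rangle=-\sum_{i=1}^t x_iy_i+\sum_{i=t+1}^4 x_iy_i$. $N^3_1(c)$ denotes $\{x\in\mathbb{R}^{4}_1:\langle x,x\rangle=1/c\}$ if $c>0$ and $\{x\in\mathbb{R}^{4}_{2}:\langle x,x\rangle=1/c\}$ if $c<0$, with the induced metric of index $1$; its curvature is $R(X,Y)Z=c(\langle Y,Z\rangle X-\langle X,Z\rangle Y)$. *)

(* Defs.v *)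
From HB Require Import structures.
From mathcomp Require Import all_boot all_order all_algebra.
From mathcomp Require Import all_classical all_reals all_analysis.

Set Implicit Arguments.
Unset Strict Implicit.
Unset Printing Implicit Defensive.

Import Order.TTheory GRing.Theory Num.Theory.
Import numFieldNormedType.Exports.

Local Open Scope classical_set_scope.
Local Open Scope ring_scope.

Definition pseudo_dot (R : realType) (t : nat) (x y : 'rV[R]_4) : R :=
  \sum_(i < 4) (if (i < t)%N then -1 else 1) * (x ord0 i * y ord0 i).

(* The index of the ambient space: R^4_1 if 0 < c and R^4_2 if c < 0 (the value
   at c = 0 is irrelevant). *)
Definition ambient_index (R : realType) (c : R) : nat :=
  if 0 < c then 1%N else 2%N.

Definition dot (R : realType) (c : R) (x y : 'rV[R]_4) : R :=
  pseudo_dot (ambient_index c) x y.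

Definition space_form (R : realType) (c : R) : set 'rV[R]_4 :=
  [set x | dot c x x = c^-1].

(* The tangent space of [space_form c] at x is the orthogonal complement of the
   position vector x. *)
Definition tangent (R : realType) (c : R) (x v : 'rV[R]_4) : Prop :=
  dot c v x = 0.

Definition tangent_proj (R : realType) (c : R) (x v : 'rV[R]_4) : 'rV[R]_4 :=
  v - (dot c v x / dot c x x) *: x.

(* Levi-Civita covariant derivative along g, for the induced metric: by the
   Gauss formula it is the tangential part of the derivative in R^4_t. *)
Definition cov_deriv (R : realType) (c : R) (g X : R -> 'rV[R]_4) :
    R -> 'rV[R]_4 :=
  fun s => tangent_proj c (g s) (derive1 X s).

(* Sign convention: R(X,Y)Z = D_X D_Y Z - D_Y D_X Z - D_[X,Y] Z. *)
Definition curvature (R : realType) (c : R) (X Y Z : 'rV[R]_4) : 'rV[R]_4 :=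
  c *: (dot c Y Z *: X - dot c X Z *: Y).

(* On an open set I this is smoothness of f on I; it does not depend on the
   values of f outside I. *)
Definition smooth_on (R : realType) (I : set R) (f : R -> 'rV[R]_4) : Prop :=
  forall (n : nat) (s : R), I s -> derivable (derive1n n f) s 1.

Record unit_speed_curve (R : realType) (c : R) (I : set R)
    (g : R -> 'rV[R]_4) : Prop := UnitSpeedCurve {
  usc_open : open I;
  usc_itv : is_interval I;
  usc_neq0 : I !=set0;
  usc_smooth : smooth_on I g;
  usc_in : forall s, I s -> space_form c (g s);
  usc_unit : forall s, I s -> `|dot c (derive1 g s) (derive1 g s)| = 1 }.

Definition geodesic (R : realType) (c : R) (I : set R)
    (g : R -> 'rV[R]_4) : Prop :=
  forall s, I s -> cov_deriv c g (derive1 g) s = 0.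

Definition bitension (R : realType) (c : R) (g : R -> 'rV[R]_4) (s : R) :
    'rV[R]_4 :=
  let T := derive1 g in
  cov_deriv c g (cov_deriv c g (cov_deriv c g T)) s
  + curvature c (cov_deriv c g T s) (T s) (T s).

Definition biharmonic (R : realType) (c : R) (I : set R)
    (g : R -> 'rV[R]_4) : Prop :=
  forall s, I s -> bitension c g s = 0.

Definition proper_biharmonic (R : realType) (c : R) (I : set R)
    (g : R -> 'rV[R]_4) : Prop :=
  biharmonic c I g /\ ~ geodesic c I g.

(* The two conventions for the second curvature: either it is positive, or it
   is an arbitrary real function and the frame is positive for a chosen
   orientation of the space form (the boolean selects the orientation). *)
Variant torsion_convention := PositiveTorsion | Oriented of bool.

(* The form (u, v, w) |-> det (x, u, v, w) is a volume form on the tangent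
   space at x; the orientations are those given by it and by its opposite. *)
Definition positively_oriented (R : realType) (b : bool)
    (x u v w : 'rV[R]_4) : Prop :=
  0 < (-1) ^+ b * \det (\matrix_(i < 4) tnth [tuple x; u; v; w] i).

Record frenet3 (R : realType) (c : R) (o : torsion_convention) (I : set R)
    (g N B : R -> 'rV[R]_4) (e1 e2 e3 : R) (k tau : R -> R) : Prop := Frenet3 {
  fr_curve : unit_speed_curve c I g;
  fr_smoothN : smooth_on I N;
  fr_smoothB : smooth_on I B;
  fr_tanN : forall s, I s -> tangent c (g s) (N s);
  fr_tanB : forall s, I s -> tangent c (g s) (B s);
  fr_e1 : e1 = 1 \/ e1 = -1;
  fr_e2 : e2 = 1 \/ e2 = -1;
  fr_e3 : e3 = 1 \/ e3 = -1;
  fr_TT : forall s, I s -> dot c (derive1 g s) (derive1 g s) = e1;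
  fr_NN : forall s, I s -> dot c (N s) (N s) = e2;
  fr_BB : forall s, I s -> dot c (B s) (B s) = e3;
  fr_TN : forall s, I s -> dot c (derive1 g s) (N s) = 0;
  fr_TB : forall s, I s -> dot c (derive1 g s) (B s) = 0;
  fr_NB : forall s, I s -> dot c (N s) (B s) = 0;
  fr_DT : forall s, I s -> cov_deriv c g (derive1 g) s = (e2 * k s) *: N s;
  fr_DN : forall s, I s ->
    cov_deriv c g N s = - (e1 * k s) *: derive1 g s + (e3 * tau s) *: B s;
  fr_DB : forall s, I s -> cov_deriv c g B s = - (e2 * tau s) *: N s;
  fr_k_gt0 : forall s, I s -> 0 < k s;
  fr_tau : forall s, I s ->
    match o return Prop with
    | PositiveTorsion => 0 < tau s
    | Oriented b => positively_oriented b (g s) (derive1 g s) (N s) (B s)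
    end }.

Definition helix3 (R : realType) (c : R) (o : torsion_convention) (I : set R)
    (g N B : R -> 'rV[R]_4) (e1 e2 e3 : R) (kappa tau : R) : Prop :=
  frenet3 c o I g N B e1 e2 e3 (fun=> kappa) (fun=> tau).

(* Main.v *)
(** By the Frenet equations the bitension of a helix is
    [kappa (c e1 e2 - e1 kappa^2 - e3 tau^2) N], so a helix, which is never a
    geodesic since [kappa > 0], is proper biharmonic iff
    [e1 kappa^2 + e3 tau^2 = c e1 e2]. The four cases come from
    [e1 e2 e3 = -1], i.e. the tangent spaces have index 1: the Gram matrix
    [diag (1/c, e1, e2, e3)] of [(g, T, N, B)] is [A E A^T] with [E] the diagonal
    matrix of the ambient form, hence its determinant has the sign of
    [\det E = (-1)^t]. *)

Require Import Defs.
From mathcomp Require Import all_boot all_order all_algebra.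
From mathcomp Require Import all_classical all_reals all_analysis.
From mathcomp Require Import ring lra.

Import Order.TTheory GRing.Theory Num.Theory.
Import numFieldNormedType.Exports.

Local Open Scope classical_set_scope.
Local Open Scope ring_scope.

Set Implicit Arguments.
Unset Strict Implicit.

Lemma pseudo_dotC (R : realType) (t : nat) (x y : 'rV[R]_4) :
  pseudo_dot t x y = pseudo_dot t y x.
Proof. by apply: eq_bigr => i _; rewrite [x _ _ * _]mulrC. Qed.

Lemma pseudo_dotZl (R : realType) (t : nat) (a : R) (x y : 'rV[R]_4) :
  pseudo_dot t (a *: x) y = a * pseudo_dot t x y.
Proof. by rewrite mulr_sumr; apply: eq_bigr => i _; rewrite mxE; ring. Qed.

Lemma pseudo_dotDl (R : realType) (t : nat) (x y z : 'rV[R]_4) :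
  pseudo_dot t (x + y) z = pseudo_dot t x z + pseudo_dot t y z.
Proof. by rewrite -big_split; apply: eq_bigr => i _; rewrite mxE /=; ring. Qed.

Definition pseudo_mx (R : realType) (t : nat) : 'M[R]_4 :=
  diag_mx (\row_(i < 4) (if (i < t)%N then -1 else 1)).

Lemma pseudo_dot_mx (R : realType) (t : nat) (A : 'M[R]_4) (i j : 'I_4) :
  (A *m pseudo_mx R t *m A^T) i j = pseudo_dot t (row i A) (row j A).
Proof.
rewrite mxE; apply: eq_bigr => k _.
by rewrite mul_mx_diag !mxE; ring.
Qed.

(** Leibniz rule, obtained coordinatewise: a row-valued function is derivable exactly when its
    entries are. *)
Lemma is_derive_pseudo_dot (R : realType) (t : nat) (f h : R -> 'rV[R]_4)
    (s : R) :
  derivable f s 1 -> derivable h s 1 ->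
  is_derive s 1 (fun u => pseudo_dot t (f u) (h u))
    (pseudo_dot t (derive1 f s) (h s) + pseudo_dot t (f s) (derive1 h s)).
Proof.
move=> df dh.
have /derivable_mxP df' := df; have /derivable_mxP dh' := dh.
have H (i : 'I_4) := is_deriveZ (if (i < t)%N then -1 else 1 : R)
  (is_deriveM (derivableP (df' ord0 i)) (derivableP (dh' ord0 i))).
have := is_derive_sum H.
have -> : \sum_(i < 4) ((if (i < t)%N then -1 else 1 : R) \*:
    ((fun x => f x ord0 i) * (fun x => h x ord0 i))) =
    (fun u => pseudo_dot t (f u) (h u)).
  by apply/funext => u; rewrite fct_sumE; apply: eq_bigr.
move=> /is_derive_eq; apply.
rewrite !derive1E (derive_mx df) (derive_mx dh) /pseudo_dot -big_split.
apply: eq_bigr => i _; rewrite /= [in RHS]mxE [in RHS]mxE.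
rewrite /GRing.scale/=.
rewrite mulrDr addrC.
by congr (_ * _ + _ * _); exact: mulrC.
Qed.

Section CovariantDerivative.
Variables (R : realType) (c : R) (g : R -> 'rV[R]_4).

(** The covariant derivative depends only on the germ of the field. Since [I] is open, a Frenet
    equation valid on [I] may thus be substituted under a further derivative. *)
Lemma near_eq_cov_deriv (X Y : R -> 'rV[R]_4) (s : R) :
  (\near s, X s = Y s) -> cov_deriv c g X s = cov_deriv c g Y s.
Proof. by move=> XY; rewrite /cov_deriv !derive1E (near_eq_derive _ XY). Qed.

Lemma cov_derivZ (a : R) (X : R -> 'rV[R]_4) (s : R) :
  derivable X s 1 -> cov_deriv c g (a \*: X) s = a *: cov_deriv c g X s.
Proof.
move=> dX; rewrite /cov_deriv /tangent_proj !derive1E deriveZ// /dot.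
by rewrite pseudo_dotZl scalerBr scalerA mulrA.
Qed.

Lemma cov_derivD (X Y : R -> 'rV[R]_4) (s : R) :
  derivable X s 1 -> derivable Y s 1 ->
  cov_deriv c g (X + Y) s = cov_deriv c g X s + cov_deriv c g Y s.
Proof.
move=> dX dY; rewrite /cov_deriv /tangent_proj !derive1E deriveD// /dot.
by rewrite pseudo_dotDl mulrDl scalerDl opprD addrACA.
Qed.

End CovariantDerivative.

(** Differentiate [dot c (g u) (g u)], which equals [c^-1] for [u] near [s]. This supplies the
    orthogonality of [g] and [T] in the Gram matrix. *)
Lemma velocity_tangent (R : realType) (c : R) (I : set R)
    (g : R -> 'rV[R]_4) (s : R) :
  unit_speed_curve c I g -> I s -> tangent c (g s) (derive1 g s).
Proof.
move=> [oI _ _ sg ing _] Is.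
have dg : derivable g s 1 := sg 0%N s Is.
have /@derive_val D1 := is_derive_pseudo_dot (ambient_index c) dg dg.
have : 'D_1 (fun u => dot c (g u) (g u)) s = 'D_1 (cst c^-1) s.
  apply: near_eq_derive; have := open_nbhs_nbhs (conj oI Is).
  by apply: filterS => u /ing.
rewrite derive_cst D1 [pseudo_dot _ (g s) _]pseudo_dotC /tangent /dot.
by lra.
Qed.

Lemma frenet_index (R : realType) (c : R) (o : torsion_convention)
    (I : set R) (g N B : R -> 'rV[R]_4) (e1 e2 e3 : R) (k tau : R -> R) :
  c != 0 -> frenet3 c o I g N B e1 e2 e3 k tau -> e1 * e2 * e3 = -1.
Proof.
move=> c0 F; have [s Is] := usc_neq0 (fr_curve F).
have tT := velocity_tangent (fr_curve F) Is.
pose b := [tuple g s; derive1 g s; N s; B s].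
pose A : 'M[R]_4 := \matrix_(i < 4) tnth b i.
pose d : 'rV[R]_4 := \row_(i < 4) tnth [tuple c^-1; e1; e2; e3] i.
have gram : A *m pseudo_mx R (ambient_index c) *m A^T = diag_mx d.
  apply/matrixP => i j; rewrite pseudo_dot_mx !rowK -/(dot c _ _) !mxE.
  have dC x y : dot c x y = dot c y x by exact: pseudo_dotC.
  have gg : dot c (g s) (g s) = c^-1 := usc_in (fr_curve F) Is.
  have tN := fr_tanN F Is; have tB := fr_tanB F Is.
  have TN := fr_TN F Is; have TB := fr_TB F Is; have NB := fr_NB F Is.
  rewrite /tangent in tT tN tB.
  (* Each of the sixteen entries is a norm or an orthogonality relation of the frame, up to the
     symmetry [dC]. *)
  case: i => [[|[|[|[|i]]]] Hi]//; case: j => [[|[|[|[|j]]]] Hj]//=;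
  rewrite /tnth/= ?mulr1n ?mulr0n ?(fr_TT F Is) ?(fr_NN F Is) ?(fr_BB F Is)//;
  by rewrite dC.
have : \det A ^+ 2 * \det (pseudo_mx R (ambient_index c)) =
    c^-1 * (e1 * e2 * e3).
  have := congr1 determinant gram.
  rewrite !det_mulmx det_tr !det_diag !big_ord_recl !big_ord0 !mxE /tnth/=.
  by move=> H; rewrite expr2 mulrAC H; ring.
have ce : c^-1 * (e1 * e2 * e3) != 0.
  rewrite !mulf_eq0 invr_eq0 (negbTE c0)/=.
  have e0 (e : R) : e = 1 \/ e = -1 -> e == 0 = false.
    by case=> ->; rewrite ?oppr_eq0 oner_eq0.
  by rewrite !e0//; [exact: fr_e3 F|exact: fr_e2 F|exact: fr_e1 F].
have e123 : e1 * e2 * e3 = 1 \/ e1 * e2 * e3 = -1.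
  by case: (fr_e1 F) => ->; case: (fr_e2 F) => ->; case: (fr_e3 F) => ->;
    rewrite ?mulNr ?mulrN ?mulr1 ?opprK; auto.
rewrite det_diag !big_ord_recl big_ord0 !mxE /ambient_index/=.
case: e123 ce => // -> /[swap].
have [cp|cn] := ltP 0 c => /=.
  have ci : 0 < c^-1 by rewrite invr_gt0.
  have : 0 <= \det A ^+ 2 by exact: sqr_ge0.
  by nra.
have ci : c^-1 < 0 by rewrite invr_lt0 lt_neqAle c0.
have : 0 <= \det A ^+ 2 by exact: sqr_ge0.
by nra.
Qed.

(** With constant curvatures, the Frenet equations applied three times leave only a multiple of [N],
    and the curvature term is [c * e1] times the covariant derivative of [T], because [T] is
    orthogonal to [N]. *)
Lemma helix_bitension (R : realType) (c : R) (o : torsion_convention)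
    (I : set R) (g N B : R -> 'rV[R]_4) (e1 e2 e3 kappa tau : R) (s : R) :
  helix3 c o I g N B e1 e2 e3 kappa tau -> I s ->
  bitension c g s =
  (kappa * (c * e1 * e2 - e1 * kappa ^+ 2 - e3 * tau ^+ 2)) *: N s.
Proof.
move=> F Is; have C := fr_curve F.
have near_I u : I u -> \near u, I u.
  by move=> Iu; exact: open_nbhs_nbhs (conj (usc_open C) Iu).
have dT u : I u -> derivable (derive1 g) u 1 by exact: usc_smooth C 1%N u.
have dN u : I u -> derivable N u 1 by exact: fr_smoothN F 0%N u.
have dB u : I u -> derivable B u 1 by exact: fr_smoothB F 0%N u.
have e22 : e2 ^+ 2 = 1 by case: (fr_e2 F) => ->; rewrite ?sqrrN expr1n.
(* Stated on all of [I], not only at [s], because it is differentiated once more. *)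
have D2 u : I u -> cov_deriv c g (cov_deriv c g (derive1 g)) u =
    ((- (e2 * kappa * (e1 * kappa))) \*: (derive1 g)
     + (e2 * kappa * (e3 * tau)) \*: B) u.
  move=> Iu; rewrite (@near_eq_cov_deriv _ _ _ _ ((e2 * kappa) \*: N)).
    by rewrite cov_derivZ ?(fr_DN F Iu)//; last exact: dN;
      rewrite scalerDr !scalerA mulrN.
  by apply: filterS (near_I u Iu) => v /(fr_DT F).
rewrite /bitension (near_eq_cov_deriv _ _ (filterS D2 (near_I s Is))).
have dTs := dT s Is; have dBs := dB s Is.
rewrite cov_derivD; try exact: derivableZ.
rewrite !cov_derivZ// (fr_DT F Is) (fr_DB F Is) /curvature /dot.
rewrite pseudo_dotZl [pseudo_dot _ (N s) _]pseudo_dotC.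
rewrite -!/(dot c _ _) (fr_TT F Is) (fr_TN F Is) mulr0 scale0r subr0.
rewrite !scalerA -!scalerDl; congr (_ *: _).
(* The first and the last Frenet equation each contribute a factor [e2], whence the relation
   [e2 ^+ 2 = 1]. *)
by ring: e22.
Qed.

Lemma frenet_normal_neq0 (R : realType) (c : R) (o : torsion_convention)
    (I : set R) (g N B : R -> 'rV[R]_4) (e1 e2 e3 : R) (k tau : R -> R) (s : R) :
  frenet3 c o I g N B e1 e2 e3 k tau -> I s -> N s != 0.
Proof.
move=> F Is; apply/eqP => N0; have := fr_NN F Is.
rewrite N0 -(scale0r 0) /dot pseudo_dotZl mul0r => e20.
by case: (fr_e2 F); lra.
Qed.

Lemma frenet_not_geodesic (R : realType) (c : R) (o : torsion_convention)
    (I : set R) (g N B : R -> 'rV[R]_4) (e1 e2 e3 : R) (k tau : R -> R) :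
  frenet3 c o I g N B e1 e2 e3 k tau -> ~ geodesic c I g.
Proof.
move=> F G; have [s Is] := usc_neq0 (fr_curve F).
have /eqP := G s Is; have := fr_k_gt0 F Is.
rewrite (fr_DT F Is) scaler_eq0 (negbTE (frenet_normal_neq0 F Is)).
by rewrite orbF => k0 /eqP; case: (fr_e2 F) => ->; lra.
Qed.

(** The coefficient of [N] in the bitension does not depend on the point and [N] never vanishes, so
    a single point of [I] decides. The factor [kappa > 0] cancels. *)
Lemma helix_proper_biharmonic (R : realType) (c : R) (o : torsion_convention)
    (I : set R) (g N B : R -> 'rV[R]_4) (e1 e2 e3 kappa tau : R) :
  helix3 c o I g N B e1 e2 e3 kappa tau ->
  proper_biharmonic c I g <->
  e1 * kappa ^+ 2 + e3 * tau ^+ 2 = c * e1 * e2.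
Proof.
move=> F; have [s Is] := usc_neq0 (fr_curve F).
split=> [[/(_ s Is) + _]|H].
  rewrite (helix_bitension F Is) => /eqP.
  rewrite scaler_eq0 (negbTE (frenet_normal_neq0 F Is)) orbF.
  rewrite mulf_eq0 gt_eqF ?(fr_k_gt0 F Is)//= => /eqP.
  by lra.
split; last exact: frenet_not_geodesic F.
move=> u Iu; rewrite (helix_bitension F Iu) -H.
by rewrite [X in _ * X](_ : _ = 0) ?mulr0 ?scale0r//; ring.
Qed.

Unset Implicit Arguments.
Set Strict Implicit.

Theorem corollary1p15 (R : realType) (c : R) (o : torsion_convention)
    (I : set R) (g N B : R -> 'rV[R]_4) (e1 e2 e3 kappa tau : R)
    (hc : c != 0) (hg : helix3 c o I g N B e1 e2 e3 kappa tau) :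
  [/\ c < 0 -> e2 = 1 ->
        (proper_biharmonic c I g <-> tau ^+ 2 - kappa ^+ 2 = - c),
      c < 0 -> e2 = -1 ->
        (proper_biharmonic c I g <-> tau ^+ 2 + kappa ^+ 2 = - c),
      0 < c -> e2 = 1 ->
        (proper_biharmonic c I g <-> kappa ^+ 2 = tau ^+ 2 + c)
    & 0 < c -> e2 = -1 -> ~ proper_biharmonic c I g].
Proof.
have idx := frenet_index hc hg.
have iff := helix_proper_biharmonic hg.
have e1P := fr_e1 hg.
split=> cs e2E; rewrite {}e2E in iff idx; rewrite iff.
(* For [e2 = 1] the index relation reads [e1 * e3 = -1], for [e2 = -1] it reads [e1 * e3 = 1]; the
   common sign [e1] then cancels from the criterion. *)
- have -> : e3 = - e1 by case: e1P idx => ->; lra.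
  by case: e1P => ->; split; lra.
- have -> : e3 = e1 by case: e1P idx => ->; lra.
  by case: e1P => ->; split; lra.
- have -> : e3 = - e1 by case: e1P idx => ->; lra.
  by case: e1P => ->; split; lra.
- have -> : e3 = e1 by case: e1P idx => ->; lra.
  (* The criterion has become [kappa ^+ 2 + tau ^+ 2 = - c], a nonnegative number equal to a
     negative one. *)
  have := sqr_ge0 kappa; have := sqr_ge0 tau.
  by case: e1P => ->; lra.
Qed.
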